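(* Let $r$ be a positive integer, let $n$ be a non-negative integer, and let $b$ be a complex number that is not an integer. Then $$ F(-2n,\, b,\, -2n+2r-b,\, -1)= \frac{\left(\tfrac{1}{2}\right)_n\,(b+1-r)_n}{\left(\tfrac{b}{2}+1-r\right)_n\left(\tfrac{b}{2}+\tfrac{1}{2}-r\right)_n} \cdot \sum_{i=0}^{r-1} \frac{2^{2i}\, i!\, \binom{r+i-1}{2i}}{(b-r+1)_i}\binom{n}{i}. $$
   Context: For a complex number $z$ and a non-negative integer $k$, $(z)_k := z(z+1)(z+2)\cdots(z+k-1)$ denotes the rising factorial, with $(z)_0=1$. For a non-negative integer $m$ and complex $b,c,x$ with $(c)_k\neq 0$ for $0\le k\le m$, the terminating hypergeometric series is $$F(-m,\, b,\, c,\, x) := \sum_{k=0}^{m} \frac{(-m)_k\,(b)_k}{k!\,(c)_k}\,x^k .$$ For $b$ not an integer, all denominators appearing in the identity are nonzero. *)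

(* Defs.v *)
From mathcomp Require Import all_boot all_order all_algebra.

Set Implicit Arguments.
Unset Strict Implicit.
Unset Printing Implicit Defensive.

Import GRing.Theory.
Local Open Scope ring_scope.

Definition rising_fact (K : nzRingType) (z : K) (k : nat) : K :=
  \prod_(j < k) (z + j%:R).

(* [hyp2F1_term m b c x] is F(-m, b, c, x): the numerator parameter -m is
   given through the natural number m, which is also the last summation index.
   Division is total here (x / 0 = 0), so the value is the intended one only
   when [rising_fact c k != 0] for all k <= m. *)
Definition hyp2F1_term (K : fieldType) (m : nat) (b c x : K) : K :=
  \sum_(k < m.+1)
    rising_fact (- m%:R) k * rising_fact b k / (k`!%:R * rising_fact c k)
      * x ^+ k.

(* Main.v *)
(** Up to the factor [(b-2r+1)_(2n)], the left-hand side is [(2n)!] times the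
coefficient of [t^(2n)] in
[(1+t)^(-b) (1-t)^(-(b-2r+1)) = (1-t^2)^(-b) (1-t)^(2r-1)], so only the even
part of [(1-t)^(2r-1)] matters; expanding that even part in the basis
[t^(2i) (1-t^2)^(r-1-i)] (Morgan-Voyce polynomials) gives the sum over [i].
Power series are avoided: both sides are polynomials in [b], so it suffices to
treat [b = -m], where everything is a polynomial in [t]. *)

Require Import Defs.
From mathcomp Require Import all_boot all_order all_algebra.
From mathcomp Require Import reals.
From mathcomp Require Import complex.
From mathcomp Require Import zify ring.

Import GRing.Theory.
Local Open Scope ring_scope.

(** * Rising factorials: splitting, reflection, duplication *)

Lemma rising_fact0 (K : nzRingType) (z : K) : rising_fact z 0 = 1.
Proof. by rewrite /rising_fact big_ord0. Qed.

Lemma rising_factS (K : nzRingType) (z : K) k :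
  rising_fact z k.+1 = rising_fact z k * (z + k%:R).
Proof. by rewrite /rising_fact big_ord_recr. Qed.

Lemma rising_factD (K : nzRingType) (z : K) j k :
  rising_fact z (j + k) = rising_fact z j * rising_fact (z + j%:R) k.
Proof.
elim: k => [|k IHk]; first by rewrite addn0 rising_fact0 mulr1.
by rewrite addnS !rising_factS IHk -mulrA natrD addrA.
Qed.

Lemma rmorph_rising_fact (K L : nzRingType) (f : {rmorphism K -> L}) z k :
  f (rising_fact z k) = rising_fact (f z) k.
Proof.
rewrite /rising_fact rmorph_prod.
by apply: eq_bigr => j _; rewrite rmorphD rmorph_nat.
Qed.

Lemma rising_fact_neq0 (K : idomainType) (z : K) k :
  (forall j, z + j%:R != 0) -> rising_fact z k != 0.
Proof. by move=> z_neq; apply/prodf_neq0 => j _. Qed.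

(** Reading the product backwards, each factor [z + (k - 1 - j)] is the opposite of
    [(1 - k - z) + j]. *)
Lemma rising_fact_rev (K : comNzRingType) (z : K) k :
  rising_fact z k = (-1) ^+ k * rising_fact (1 - k%:R - z) k.
Proof.
rewrite /rising_fact -[k in (-1) ^+ k]card_ord -prodr_const -big_split /=.
rewrite [LHS](reindex_inj rev_ord_inj) /=; apply: eq_bigr => j _.
by rewrite natrB ?ltn_ord // -natr1; ring.
Qed.

Lemma rising_fact_Nnat (K : comNzRingType) m k :
  rising_fact (- m%:R : K) k = (-1) ^+ k * (k`! * 'C(m, k))%:R.
Proof.
rewrite mulnC bin_ffact; elim: k => [|k IHk].
  by rewrite rising_fact0 ffactn0 mul1r.
rewrite rising_factS IHk ffactnSr natrM exprS.
(* The factor [m - k] is a truncated subtraction; for [m < k] this is harmless because the falling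
   factorial is already zero. *)
have [le_km|lt_mk] := leqP k m; first by rewrite natrB //; ring.
by rewrite ffact_small // !(mul0r, mulr0).
Qed.

Lemma rising_fact1 (K : comNzRingType) k : rising_fact (1 : K) k = k`!%:R.
Proof.
elim: k => [|k IHk]; first by rewrite rising_fact0.
by rewrite rising_factS IHk factS mulnC natrM -natr1 addrC.
Qed.

(** The factors are grouped in consecutive pairs: [(z + 2n)(z + 2n + 1) = 4 (z/2 + n)((z + 1)/2 +
    n)]. *)
Lemma rising_fact_double (K : fieldType) (z : K) n : (2 : K) != 0 ->
  rising_fact z (2 * n) =
    4 ^+ n * (rising_fact (z / 2) n * rising_fact ((z + 1) / 2) n).
Proof.
move=> two_neq0; elim: n => [|n IHn].
  by rewrite muln0 !rising_fact0 !mulr1.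
by rewrite mulnS !rising_factS IHn exprS -natr1 natrM; field.
Qed.

(** * Morgan-Voyce polynomials and alternating sums of binomials *)

(* The Morgan-Voyce polynomials, homogenized: both families are needed since
   Pascal's rule expresses each in terms of the other. *)
Lemma morgan_voyce_closed (K : comNzRingType) (x y : K) s :
  (x + y) * (\sum_(i < s.+1)
     'C(s + i, 2 * i)%:R * ((x - y) ^+ 2) ^+ i * (x * y) ^+ (s - i))
    = x ^+ (2 * s).+1 + y ^+ (2 * s).+1
  /\ (x - y) * (x + y) * (\sum_(i < s)
     'C(s + i, (2 * i).+1)%:R * ((x - y) ^+ 2) ^+ i * (x * y) ^+ (s - i.+1))
    = x ^+ (2 * s) - y ^+ (2 * s).
Proof.
set a := (x - y) ^+ 2; set q := x * y.
pose U s := \sum_(i < s.+1) 'C(s + i, 2 * i)%:R * a ^+ i * q ^+ (s - i).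
pose V s := \sum_(i < s) 'C(s + i, (2 * i).+1)%:R * a ^+ i * q ^+ (s - i.+1).
have V_S t : V t.+1 = U t + q * V t.
  rewrite /V [q * _]mulr_sumr big_ord_recr /= /U big_ord_recr /= addrAC.
  rewrite -big_split /=; congr (_ + _); last first.
    by rewrite !subnn addSn !mul2n addnn !binn.
  apply: eq_bigr => i _; rewrite addSn binS natrD subSS.
  by rewrite -[(t - i)%N](subnSK (ltn_ord i)) exprS; ring.
(* Pascal's rule applies only from index 1 on: the term of index 0 comes from [q * U t] alone, and
   the top one from [a * V t.+1] alone. *)
have U_S t : U t.+1 = q * U t + a * V t.+1.
  rewrite /U big_ord_recl /= [in q * _]big_ord_recl /= mulrDr -addrA.
  congr (_ + _).
    by rewrite !muln0 !bin0 !subn0 !expr0 exprS; ring.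
  rewrite /V big_ord_recr /= [in a * _]big_ord_recr /= mulrDr addrA.
  congr (_ + _); last first.
    rewrite /bump /= !add1n !subnn addnn -mul2n binn.
    by rewrite addSn addnn -mul2n binn exprS; ring.
  rewrite [q * _]mulr_sumr [a * _]mulr_sumr -big_split /=.
  apply: eq_bigr => i _; rewrite /bump /= !add1n !subSS.
  rewrite [(2 * i.+1)%N]mulnS add2n addSn addnS binS natrD addSn.
  by rewrite -[(t - i)%N](subnSK (ltn_ord i)) !exprS; ring.
change ((x + y) * U s = x ^+ (2 * s).+1 + y ^+ (2 * s).+1
  /\ (x - y) * (x + y) * V s = x ^+ (2 * s) - y ^+ (2 * s)).
elim: s => [|s [IHU IHV]].
  by rewrite /U /V big_ord1 big_ord0 !muln0 bin0 !expr0 !expr1; split; ring.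
have IHV' : (x - y) * (x + y) * V s.+1 = x ^+ (2 * s.+1) - y ^+ (2 * s.+1).
  rewrite V_S mulrDr -mulrA IHU mulrCA IHV mulnS add2n !exprS /q; ring.
split=> //.
rewrite U_S mulrDr mulrCA IHU.
(* Since [a] is [(x - y) ^+ 2], one factor [x - y] completes the closed form of [V] and the other
   stays outside. *)
have -> : (x + y) * (a * V s.+1) = (x - y) * ((x - y) * (x + y) * V s.+1).
  by rewrite /a; ring.
by rewrite IHV' mulnS add2n !exprS /q; ring.
Qed.

Lemma signr_double_sub (K : nzRingType) n k : (k <= 2 * n)%N ->
  (-1) ^+ (2 * n - k) = (-1) ^+ k :> K.
Proof.
by move=> le_k; rewrite -signr_odd oddB // mul2n odd_double signr_odd.
Qed.

Lemma coef_expr1DZX (K : comNzRingType) (c : K) m k :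
  ((1 + c *: 'X) ^+ m)`_k = c ^+ k * 'C(m, k)%:R.
Proof.
rewrite exprDn coef_sum.
have [le_km|lt_mk] := leqP k m; last first.
  rewrite bin_small // mulr0 big1 // => i _.
  rewrite expr1n mul1r exprZn coefMn coefZ coefXn.
  have -> : (k == i :> nat) = false by have := ltn_ord i; lia.
  by rewrite mulr0 mul0rn.
rewrite (bigD1 (Ordinal (n:=m.+1) le_km)) //= big1 ?addr0.
  by rewrite expr1n mul1r exprZn coefMn coefZ coefXn eqxx mulr1 mulr_natr.
move=> i ne_ik; rewrite expr1n mul1r exprZn coefMn coefZ coefXn.
rewrite (_ : (k == i :> nat) = false) ?mulr0 ?mul0rn //.
by apply: contraNF ne_ik => /eqP eq_ki; apply/eqP/val_inj.
Qed.

(* Compares the coefficients of [t ^ (2 n)] in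
   [(1 - t^2)^m ((1 - t)^(2s+1) + (1 + t)^(2s+1))]. *)
Lemma sum_bin_alternating (K : numDomainType) m s n :
  \sum_(k < (2 * n).+1)
     (-1) ^+ k * 'C(m, k)%:R * 'C(m + (2 * s).+1, 2 * n - k)%:R
  = \sum_(i < s.+1) 4 ^+ i * 'C(s + i, 2 * i)%:R *
      (if (n < i)%N then 0 else (-1) ^+ (n - i) * 'C(m + s - i, n - i)%:R) :> K.
Proof.
pose x : {poly K} := 1 + 1 *: 'X; pose y : {poly K} := 1 + (-1) *: 'X.
have xDy : x + y = 2 by rewrite /x /y scaleN1r scale1r; ring.
have xBy : (x - y) ^+ 2 = 4 * 'X^2 by rewrite /x /y scaleN1r scale1r; ring.
have xMy : x * y = y \Po 'X^2.
  rewrite /x /y !scaleN1r scale1r rmorphD rmorphN /= comp_polyX rmorph1; ring.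
have coef_prod c d p q N : (((1 + c *: 'X) ^+ p * (1 + d *: 'X) ^+ q) : {poly K})`_N
    = \sum_(k < N.+1) c ^+ k * d ^+ (N - k) * ('C(p, k)%:R * 'C(q, N - k)%:R).
  by rewrite coefM; apply: eq_bigr => k _; rewrite !coef_expr1DZX; ring.
(* In the variable [t^2], [E] is half of the symmetrized product; here [y] evaluated at [t^2] is
   [x * y = 1 - t^2]. *)
pose E := \sum_(i < s.+1)
  (4 ^+ i * 'C(s + i, 2 * i)%:R) *: ('X^i * y ^+ (m + s - i)).
have mulE : x ^+ m * y ^+ (m + (2 * s).+1) + y ^+ m * x ^+ (m + (2 * s).+1)
    = 2 * (E \Po 'X^2).
  have -> : x ^+ m * y ^+ (m + (2 * s).+1) + y ^+ m * x ^+ (m + (2 * s).+1)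
     = (x * y) ^+ m * (x ^+ (2 * s).+1 + y ^+ (2 * s).+1).
    by rewrite exprMn !exprD; ring.
  have [<- _] := morgan_voyce_closed _ x y s.
  rewrite xDy mulrCA; congr (_ * _).
  rewrite xBy mulr_sumr rmorph_sum /=; apply: eq_bigr => i _.
  rewrite comp_polyZ rmorphM !rmorphXn /= comp_polyX -xMy.
  rewrite -[(m + s - i)%N]addnBA; last by rewrite -ltnS.
  rewrite exprD [(4 * _) ^+ i]exprMn -mul_polyC rmorphM rmorphXn /= !polyC_natr.
  ring.
transitivity E`_n; last first.
  rewrite coef_sum; apply: eq_bigr => i _.
  by rewrite coefZ coefXnM coef_expr1DZX.
(* The two products in [mulE] are exchanged by [t -> -t], so they have the same coefficient in the
   even degree [2 * n]; doubling the goal lets both be used. *)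
apply: (@Num.Theory.pmulrnI K 2) => //.
have -> : E`_n = (E \Po 'X^2)`_(2 * n).
  by rewrite coef_comp_poly_Xn // dvdn_mulr // mulKn.
rewrite -coefMn -[(E \Po _) *+ 2]mulr_natl -mulE coefD !coef_prod mulr2n.
congr (_ + _); apply: eq_bigr => k _.
  by rewrite signr_double_sub ?leq_ord // expr1n mul1r mulrA.
by rewrite expr1n mulr1 mulrA.
Qed.

(** * Convolution of rising factorials *)

(** At [b = - m] every rising factorial is a signed factorial times a binomial, which reduces the
    claim to [sum_bin_alternating]. The factor [n!] avoids division, as [n! = n ^_ i * (n - i)!]. *)
Lemma convolution_rising_fact_Nnat (K : numDomainType) m s n
    (b := - m%:R : K) :
  n`!%:R * \sum_(k < (2 * n).+1) (-1) ^+ k * 'C(2 * n, k)%:R *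
      (rising_fact b k * rising_fact (b - (2 * s).+1%:R) (2 * n - k))
  = (2 * n)`!%:R * \sum_(i < s.+1) 4 ^+ i * 'C(s + i, 2 * i)%:R *
      ((n ^_ i)%:R * rising_fact (b - s%:R + i%:R) (n - i)).
Proof.
have fact_sum : \sum_(k < (2 * n).+1) (-1) ^+ k * 'C(2 * n, k)%:R *
      (rising_fact b k * rising_fact (b - (2 * s).+1%:R) (2 * n - k))
    = (2 * n)`!%:R * \sum_(k < (2 * n).+1)
     (-1) ^+ k * 'C(m, k)%:R * 'C(m + (2 * s).+1, 2 * n - k)%:R.
  rewrite mulr_sumr; apply: eq_bigr => k _.
  have le_k : (k <= 2 * n)%N by rewrite -ltnS.
  rewrite /b -opprD -natrD !rising_fact_Nnat -(bin_fact le_k) !natrM.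
  rewrite signr_double_sub //.
  (* Three signs [(-1) ^+ k] meet on the left and one on the right; [ring] needs to know that this
     sign squares to 1. *)
  have /= sgnK := signrMK k (1 : K).
  rewrite !mulr1 in sgnK.
  ring: sgnK.
rewrite fact_sum sum_bin_alternating mulrCA; congr (_ * _).
rewrite mulr_sumr; apply: eq_bigr => i _.
rewrite mulrCA; congr (_ * _).
have [lt_ni|le_in] := ltnP n i; first by rewrite mulr0 ffact_small ?mul0r.
have -> : b - s%:R + i%:R = - (m + s - i)%:R.
  rewrite natrB; last by rewrite (leq_trans _ (leq_addl _ _)) // -ltnS.
  by rewrite natrD /b; ring.
by rewrite rising_fact_Nnat -(ffact_fact le_in) !natrM; ring.
Qed.

(** The difference vanishes at [size (p - q)] distinct points, one more than its degree allows if it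
    is nonzero. *)
Lemma poly_eq_Nnat (K : numDomainType) (p q : {poly K}) :
  (forall m : nat, p.[- m%:R] = q.[- m%:R]) -> p = q.
Proof.
move=> eq_pq; apply/eqP; rewrite -subr_eq0; apply/eqP.
apply: (@roots_geq_poly_eq0 _ _
  [seq - m%:R | m <- iota 0 (size (p - q))]); last by rewrite size_map size_iota.
  apply/allP => _ /mapP[m _ ->].
  by rewrite /root hornerD hornerN eq_pq subrr.
rewrite map_inj_uniq ?iota_uniq // => i j /oppr_inj /eqP.
by rewrite Num.Theory.eqr_nat => /eqP.
Qed.

Lemma convolution_rising_fact (K : numDomainType) (b : K) s n :
  n`!%:R * \sum_(k < (2 * n).+1) (-1) ^+ k * 'C(2 * n, k)%:R *
      (rising_fact b k * rising_fact (b - (2 * s).+1%:R) (2 * n - k))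
  = (2 * n)`!%:R * \sum_(i < s.+1) 4 ^+ i * 'C(s + i, 2 * i)%:R *
      ((n ^_ i)%:R * rising_fact (b - s%:R + i%:R) (n - i)).
Proof.
(* Both sides are stated over any commutative ring, so that they can be formed at ['X] in [{poly K}]
   and specialized by the evaluation morphism. *)
pose lhs (A : comNzRingType) (z : A) :=
  n`!%:R * \sum_(k < (2 * n).+1) (-1) ^+ k * 'C(2 * n, k)%:R *
      (rising_fact z k * rising_fact (z - (2 * s).+1%:R) (2 * n - k)).
pose rhs (A : comNzRingType) (z : A) :=
  (2 * n)`!%:R * \sum_(i < s.+1) 4 ^+ i * 'C(s + i, 2 * i)%:R *
      ((n ^_ i)%:R * rising_fact (z - s%:R + i%:R) (n - i)).
have lhs_morph (A B : comNzRingType) (f : {rmorphism A -> B}) z :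
    f (lhs A z) = lhs B (f z).
  rewrite rmorphM rmorph_nat rmorph_sum; congr (_ * _).
  apply: eq_bigr => k _; rewrite !rmorphM rmorph_sign !rmorph_nat.
  by rewrite !rmorph_rising_fact rmorphB rmorph_nat.
have rhs_morph (A B : comNzRingType) (f : {rmorphism A -> B}) z :
    f (rhs A z) = rhs B (f z).
  rewrite rmorphM rmorph_nat rmorph_sum; congr (_ * _).
  apply: eq_bigr => k _; rewrite !rmorphM rmorphXn !rmorph_nat.
  by rewrite rmorph_rising_fact rmorphD rmorphB !rmorph_nat.
have lhsE z : (lhs _ 'X).[z] = lhs K z.
  by have := lhs_morph _ _ (horner_eval z) 'X; rewrite /= /horner_eval hornerX.
have rhsE z : (rhs _ 'X).[z] = rhs K z.
  by have := rhs_morph _ _ (horner_eval z) 'X; rewrite /= /horner_eval hornerX.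
have eq_poly : lhs {poly K} 'X = rhs {poly K} 'X.
  apply: poly_eq_Nnat => m; rewrite lhsE rhsE.
  exact: convolution_rising_fact_Nnat.
by change (lhs K b = rhs K b); rewrite -lhsE eq_poly rhsE.
Qed.

(** * From the convolution to the hypergeometric series *)

(** Splitting off the last [k] factors of [rising_fact beta N] and reflecting them produces exactly
    the denominator [rising_fact (1 - N - beta) k], up to sign. *)
Lemma hyp2F1_term_convolution (K : numFieldType) N (b beta : K) :
    (forall j : nat, beta + j%:R != 0) ->
  rising_fact beta N * hyp2F1_term N b (1 - N%:R - beta) (-1)
  = \sum_(k < N.+1) (-1) ^+ k * 'C(N, k)%:R *
      (rising_fact b k * rising_fact beta (N - k)).
Proof.
move=> beta_neq; rewrite mulr_sumr; apply: eq_bigr => k _.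
have le_k : (k <= N)%N by rewrite -ltnS.
have betaE : rising_fact beta N = rising_fact beta (N - k) *
    ((-1) ^+ k * rising_fact (1 - N%:R - beta) k).
  rewrite -{1}(subnK le_k) rising_factD; congr (_ * _).
  rewrite rising_fact_rev natrB //; congr (_ * rising_fact _ _); ring.
(* The denominator divides [rising_fact beta N], which is nonzero, so no division by zero occurs. *)
have c_neq : rising_fact (1 - N%:R - beta) k != 0.
  have : rising_fact beta N != 0 by apply: rising_fact_neq0.
  by rewrite betaE !mulf_eq0 !negb_or => /and3P[].
have fact_neq : k`!%:R != 0 :> K.
  by rewrite Num.Theory.pnatr_eq0 -lt0n fact_gt0.
rewrite betaE rising_fact_Nnat natrM.
have /= sgnK := signrMK k (1 : K).
rewrite !mulr1 in sgnK.
by field: sgnK; rewrite c_neq.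
Qed.

Theorem theorem1 (R : realType) (r n : nat) (b : R[i])
    (r_gt0 : (0 < r)%N)
    (b_nonint : forall m : int, b <> m%:~R) :
  hyp2F1_term (2 * n) b (- (2 * n)%:R + (2 * r)%:R - b) (- 1) =
    rising_fact (1 / 2) n * rising_fact (b + 1 - r%:R) n
      / (rising_fact (b / 2 + 1 - r%:R) n
         * rising_fact (b / 2 + 1 / 2 - r%:R) n)
    * \sum_(i < r)
        2 ^+ (2 * i) * i`!%:R * 'C(r + i - 1, 2 * i)%:R
          / rising_fact (b - r%:R + 1) i * 'C(n, i)%:R.
Proof.
(* With [r = s + 1], the exponent [2r - 1] is [2s + 1], and [beta] below is [b - (2s + 1)]. *)
case: r r_gt0 => // s _.
have b_neq (m : int) : b + m%:~R != 0.
  by apply/eqP => /eqP; rewrite addr_eq0 -rmorphN => /eqP; apply: b_nonint.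
have beta_neq j : b - (2 * s).+1%:R + j%:R != 0.
  have := b_neq (j%:Z - (2 * s).+1%:Z).
  by rewrite intrB -!pmulrn addrA addrAC.
have bs_neq j : b - s%:R + j%:R != 0.
  have := b_neq (j%:Z - s%:Z).
  by rewrite intrB -!pmulrn addrA addrAC.
have two_neq : (2 : R[i]) != 0 by rewrite Num.Theory.pnatr_eq0.
have fact_neq k : k`!%:R != 0 :> R[i].
  by rewrite Num.Theory.pnatr_eq0 -lt0n fact_gt0.
have := convolution_rising_fact _ b s n.
rewrite -hyp2F1_term_convolution //.
have -> : 1 - (2 * n)%:R - (b - (2 * s).+1%:R)
    = - (2 * n)%:R + (2 * s.+1)%:R - b.
  by rewrite mulnS -!natr1 !natrD; ring.
set F := hyp2F1_term _ _ _ _.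
have -> : b + 1 - s.+1%:R = b - s%:R by rewrite -natr1; ring.
have -> : b - s.+1%:R + 1 = b - s%:R by rewrite -natr1; ring.
(* The two denominator parameters are [(beta + 1) / 2] and [beta / 2], so duplication turns
   [rising_fact beta (2 * n)] into [4 ^+ n] times their rising factorials. *)
have -> : b / 2 + 1 - s.+1%:R = (b - (2 * s).+1%:R + 1) / 2.
  by rewrite -!natr1 natrM; field.
have -> : b / 2 + 1 / 2 - s.+1%:R = (b - (2 * s).+1%:R) / 2.
  by rewrite -!natr1 natrM; field.
have := rising_fact_neq0 _ _ (2 * n) beta_neq.
rewrite rising_fact_double //.
set P := rising_fact ((b - _) / 2) n; set Q := rising_fact ((_ + 1) / 2) n.
rewrite !mulf_eq0 !negb_or => /and3P[four_neq P_neq Q_neq] FE.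
(* This is duplication at 1; its [4 ^+ n] cancels the one coming from [beta]. *)
have halfE : (2 * n)`!%:R = 4 ^+ n * rising_fact (1 / 2) n * n`!%:R :> R[i].
  rewrite -rising_fact1 rising_fact_double // -[1 + 1]/2 divff //.
  by rewrite rising_fact1 mulrA.
have sumE : \sum_(i < s.+1) 4 ^+ i * 'C(s + i, 2 * i)%:R *
      ((n ^_ i)%:R * rising_fact (b - s%:R + i%:R) (n - i))
    = rising_fact (b - s%:R) n * \sum_(i < s.+1)
        2 ^+ (2 * i) * i`!%:R * 'C(s.+1 + i - 1, 2 * i)%:R
          / rising_fact (b - s%:R) i * 'C(n, i)%:R.
  rewrite mulr_sumr; apply: eq_bigr => i _.
  rewrite addSn subn1 /= -bin_ffact natrM.
  have -> : 2 ^+ (2 * i) = 4 ^+ i :> R[i].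
    by rewrite exprM; congr (_ ^+ _); ring.
  (* The first [i] factors can be split off [rising_fact (b - s) n] only for [i <= n]; beyond that
     the binomial is zero on both sides. *)
  have [lt_ni|le_in] := ltnP n i; first by rewrite (bin_small lt_ni) !(mul0r, mulr0).
  have -> : rising_fact (b - s%:R) n
      = rising_fact (b - s%:R) i * rising_fact (b - s%:R + i%:R) (n - i).
    by rewrite -rising_factD subnKC.
  have : rising_fact (b - s%:R) i != 0 by apply: rising_fact_neq0.
  by move=> neq; field.
move: FE; rewrite sumE halfE.
set S := \sum_(i < s.+1) _ => FE.
have D_neq := mulf_neq0 four_neq (mulf_neq0 P_neq Q_neq).
(* The multiplier is [n!] times [rising_fact beta (2 * n)] in its duplicated form, the coefficient
   of [F] in [FE]. *)
apply: (mulfI (mulf_neq0 (fact_neq n) D_neq)).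
by rewrite -mulrA FE; field; rewrite P_neq.
Qed.
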